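(* Let $r\geq 3$ be an integer and $F$ a graph with $\chi(F)>r$. If $s$ and $n$ are sufficiently large, then $$\mathrm{ex}(n, K_r,\{F, M_{s+1}\})=\mathcal{N}(K_r,D_F(s,r)\vee I_{n-s}).$$
   Context: All graphs are finite and simple. $\mathcal{N}(H,G)$ is the number of copies of $H$ in $G$. For a family $\mathcal{F}$, a graph is $\mathcal{F}$-free if it contains no member of $\mathcal{F}$ as a subgraph; $\mathrm{ex}(n,H,\mathcal{F})$ is the maximum of $\mathcal{N}(H,G)$ over $n$-vertex $\mathcal{F}$-free graphs $G$, and $\mathrm{EX}(n,H,\mathcal{F})$ is the set of $n$-vertex $\mathcal{F}$-free graphs attaining it. $M_{s+1}$ is a matching of $s+1$ edges, $I_m$ the edgeless graph on $m$ vertices, $\vee$ the join. $\mathcal{D}(F)$ is the set of all graphs obtained from $F$ by deleting an independent set of $F$. $D_F(s,r)$ denotes a graph in $\mathrm{EX}(s,K_{r-1},\mathcal{D}(F))$ with the maximum number of copies of $K_r$. *)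

(* Defs.v *)
From HB Require Import structures.
From mathcomp Require Import all_boot.

Set Implicit Arguments.
Unset Strict Implicit.
Unset Printing Implicit Defensive.

(* A finite simple graph on T, given by its edges as two-element subsets. *)
Record sgraph (T : finType) := SGraph {
  edges : {set {set T}};
  edges_card2 : [forall e in edges, #|e| == 2]
}.

#[warnings="-projection-no-head-constant,-redundant-canonical-projection"]
HB.instance Definition _ (T : finType) := [isSub for @edges T].
#[warnings="-redundant-canonical-projection"]
HB.instance Definition _ (T : finType) := [Finite of sgraph T by <:].

Definition adj (T : finType) (G : sgraph T) : rel T :=
  fun x y => [set x; y] \in edges G.

Section OfRel.
Variables (T : finType) (e : rel T).

(* Loops of e are dropped; e is implicitly symmetrized. *)
Definition rel_edges : {set {set T}} :=
  [set [set p.1; p.2] | p : T * T & (p.1 != p.2) && e p.1 p.2].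

Lemma rel_edges_card2 : [forall a in rel_edges, #|a| == 2].
Proof.
apply/forall_inP => a /imsetP[p]; rewrite inE => /andP[neq _] ->.
by rewrite cards2 neq.
Qed.

Definition graph_of_rel : sgraph T := SGraph rel_edges_card2.
End OfRel.

Definition complete (T : finType) : sgraph T := graph_of_rel (fun _ _ => true).

Definition edgeless (T : finType) : sgraph T := graph_of_rel (fun _ _ => false).

(* The i-th edge joins (i, false) and (i, true). *)
Definition matching (m : nat) : sgraph ('I_m * bool)%type :=
  graph_of_rel (fun x y => x.1 == y.1).

Definition join (S T : finType) (G : sgraph S) (H : sgraph T) :
    sgraph (S + T)%type :=
  graph_of_rel (fun u v =>
    match u, v with
    | inl x, inl y => adj G x y
    | inr x, inr y => adj H x y
    | _, _ => true
    end).

Definition induced (T : finType) (G : sgraph T) (A : {set T}) :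
    sgraph {x | x \in A} :=
  graph_of_rel (fun x y => adj G (val x) (val y)).

Definition independent (T : finType) (G : sgraph T) (A : {set T}) : bool :=
  [forall x in A, forall y in A, ~~ adj G x y].

Definition colorable (T : finType) (G : sgraph T) (k : nat) : bool :=
  [exists c : {ffun T -> 'I_k}, forall x, forall y, adj G x y ==> (c x != c y)].

Lemma ex_colorable (T : finType) (G : sgraph T) : exists k, colorable G k.
Proof.
exists #|T|; apply/existsP; exists [ffun x => enum_rank x].
apply/forallP => x; apply/forallP => y; apply/implyP => xy.
rewrite !ffunE (inj_eq enum_rank_inj); apply: contraTneq xy => ->.
apply/negP => /(forall_inP (edges_card2 G)).
by rewrite setUid cards1.
Qed.

Definition chromatic_number (T : finType) (G : sgraph T) : nat :=
  ex_minn (ex_colorable G).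

Section Copies.
Variables (S T : finType) (H : sgraph S) (G : sgraph T).

Definition embedding (f : {ffun S -> T}) : bool :=
  injectiveb f && [forall e in edges H, f @: e \in edges G].

(* The subgraphs (vertex set, edge set) of G that are isomorphic to H; they are
   not required to be induced. *)
Definition copies : {set {set T} * {set {set T}}} :=
  [set (f @: [set: S], [set f @: (e : {set S}) | e in edges H])
     | f : {ffun S -> T} & embedding f].

Definition ncopies : nat := #|copies|.

Definition contains : bool := copies != set0.
End Copies.

Definition family := seq {T : finType & sgraph T}.

Definition free (Fs : family) (T : finType) (G : sgraph T) : bool :=
  all (fun H => ~~ contains (tagged H) G) Fs.

Definition ex (n : nat) (S : finType) (H : sgraph S) (Fs : family) : nat :=
  \max_(G : sgraph 'I_n | free Fs G) ncopies H G.

Definition EX (n : nat) (S : finType) (H : sgraph S) (Fs : family) :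
    {set sgraph 'I_n} :=
  [set G | free Fs G && (ncopies H G == ex n H Fs)].

Definition deletion_family (T : finType) (F : sgraph T) : family :=
  [seq Tagged sgraph (induced F (~: A)) | A in [set B | independent F B]].

(* All admissible choices for the graph D_F(s, r). *)
Definition DF (T : finType) (F : sgraph T) (s r : nat) : {set sgraph 'I_s} :=
  let X := EX s (complete 'I_(r - 1)) (deletion_family F) in
  [set D in X | [forall D' in X,
     ncopies (complete 'I_r) D' <= ncopies (complete 'I_r) D]].

(* Main.v *)
(** Let m = ex(s, K_(r-1), D(F)).  A graph G without s + 1 disjoint edges has a
    vertex cover W of bounded size, so all but boundedly many vertices outside W
    share their neighbourhood S with at least |F| + s + 2 other such vertices.
    Then |S| <= s (otherwise a matching of size s + 1 appears between S and the
    twins), and G[S] is D(F)-free (otherwise the deleted independent set can be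
    placed on the twins).  If |S| < s for all these S, every twin vertex lies in
    at most m - 1 copies of K_r, which is too few when n is large.  If |S| = s
    for some S, then S itself is a vertex cover, and G has at most
    N(K_r, G[S]) + (n - s) N(K_(r-1), G[S]) copies of K_r.

    The strict inequality for |S| < s comes from a Turan-type lower bound
    m > |F| s^(r-2): a graph on fewer than s vertices with m copies of K_(r-1)
    has an (r-2)-clique Q with at least |F| common neighbours, and joining the
    missing vertices to Q creates more (r-1)-cliques but no member of D(F). *)
Require Import Defs.
From mathcomp Require Import all_boot zify.

Set Implicit Arguments.
Unset Strict Implicit.
Unset Printing Implicit Defensive.

(** * Edges, adjacency and cliques as vertex sets *)

Section Basics.
Variable T : finType.
Implicit Types (G : sgraph T) (A W : {set T}).

Lemma set2_inj (x y a b : T) :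
  [set x; y] = [set a; b] -> (x = a /\ y = b) \/ (x = b /\ y = a).
Proof.
move=> E.
have /set2P hx : x \in [set a; b] by rewrite -E set21.
have /set2P hy : y \in [set a; b] by rewrite -E set22.
have /set2P ha : a \in [set x; y] by rewrite E set21.
have /set2P hb : b \in [set x; y] by rewrite E set22.
by case: hx hy ha hb => ? [] ? [] ? [] ?; subst; auto.
Qed.

Lemma card_edge G (e : {set T}) : e \in edges G -> #|e| = 2.
Proof. by move/(forall_inP (edges_card2 G))/eqP. Qed.

Lemma adj_sym G x y : adj G x y = adj G y x.
Proof. by rewrite /adj setUC. Qed.

Lemma adj_irr G x : adj G x x = false.
Proof. by apply/negP => /card_edge; rewrite setUid cards1. Qed.

Lemma adj_neq G x y : adj G x y -> x != y.
Proof. by apply: contraTneq => ->; rewrite adj_irr. Qed.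

Lemma adj_graph_of_rel (e : rel T) x y :
  adj (graph_of_rel e) x y = (x != y) && (e x y || e y x).
Proof.
apply/imsetP/andP => [[[a b]] | [nxy /orP[exy | eyx]]].
- rewrite inE /= => /andP[nab eab] /set2_inj[] [-> ->]; first by rewrite eab.
  by rewrite eq_sym eab orbT.
- by exists (x, y); rewrite // inE /= nxy.
- by exists (y, x); rewrite 1?[RHS]setUC // inE /= eq_sym nxy.
Qed.

Definition clique G A : bool :=
  [forall x in A, forall y in A, (x != y) ==> adj G x y].

Definition cliques G k : {set {set T}} :=
  [set A : {set T} | (#|A| == k) && clique G A].

Definition cliques_in G W k : {set {set T}} :=
  [set A in cliques G k | A \subset W].

Lemma cliqueP G A :
  reflect {in A &, forall x y, x != y -> adj G x y} (clique G A).
Proof.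
apply: (iffP forall_inP) => [h x y xA yA nxy | h x xA].
  by have /forall_inP/(_ y yA)/implyP := h x xA; apply.
by apply/forall_inP => y yA; apply/implyP; apply: h.
Qed.

Lemma clique_sub G A W : A \subset W -> clique G W -> clique G A.
Proof.
by move=> /subsetP AW /cliqueP h; apply/cliqueP => x y /AW xW /AW; apply: h.
Qed.

Lemma card_cliques_in G W k : #|cliques_in G W k| <= 2 ^ #|W|.
Proof.
rewrite -card_powerset; apply/subset_leq_card/subsetP => A.
by rewrite !inE => /andP[].
Qed.

Lemma cliques_inS G W W' k :
  W \subset W' -> #|cliques_in G W k| <= #|cliques_in G W' k|.
Proof.
move=> WW'; apply/subset_leq_card/subsetP => A; rewrite !inE => /andP[-> AW].
exact: subset_trans WW'.
Qed.

Lemma cliques_inT G k : cliques_in G setT k = cliques G k.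
Proof. by apply/setP => A; rewrite inE subsetT andbT. Qed.
End Basics.

(** * Containment and copies of complete graphs *)

Section Embeddings.
Variables (S T : finType) (H : sgraph S) (G : sgraph T).

Lemma embeddingP (f : {ffun S -> T}) :
  reflect (injective f /\ forall x y, adj H x y -> adj G (f x) (f y))
          (embedding H G f).
Proof.
apply: (iffP andP) => [[/injectiveP fI /forall_inP h] | [fI h]].
  by split=> // x y /h; rewrite imsetU1 imset_set1.
split; first exact/injectiveP.
apply/forall_inP => e eH; have /eqP/cards2P[x [y [nxy E]]] := card_edge eH.
by rewrite E imsetU1 imset_set1; apply: h; rewrite /adj -E.
Qed.

Lemma containsP :
  reflect (exists2 f : S -> T, injective f
             & forall x y, adj H x y -> adj G (f x) (f y))
          (contains H G).
Proof.
rewrite /contains; apply: (iffP (set0Pn _)) => [[c /imsetP[f]] | [f fI fh]].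
  by rewrite inE => /embeddingP[fI fh] _; exists f.
exists ([ffun x => f x] @: [set: S],
        [set [ffun x => f x] @: (e : {set S}) | e in edges H]).
apply/imsetP; exists [ffun x => f x] => //; rewrite inE; apply/embeddingP.
by split=> [x y | x y]; rewrite !ffunE; [apply: fI | apply: fh].
Qed.
End Embeddings.

(** The edge set of a copy of a complete graph consists of all pairs inside its vertex set, so the
    vertex set alone determines the copy. From here on all counting is done with cliques. *)
Lemma ncopies_complete k (T : finType) (G : sgraph T) :
  ncopies (complete 'I_k) G = #|cliques G k|.
Proof.
pose pairs (S : finType) (A : {set S}) :=
  [set e : {set S} | (e \subset A) && (#|e| == 2)].
have pairsE (f : {ffun 'I_k -> T}) : injective f ->
    [set f @: (e : {set 'I_k}) | e in edges (complete 'I_k)]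
      = pairs T (f @: setT).
  move=> fI; apply/setP => e; rewrite inE; apply/imsetP/andP.
    move=> [e' /card_edge ce' ->]; split; first by apply: imsetS.
    by rewrite card_imset // ce'.
  move=> [/subsetP sub /cards2P[x [y [nxy E]]]].
  have /imsetP[i _ xi] : x \in f @: setT by apply: sub; rewrite E set21.
  have /imsetP[j _ yj] : y \in f @: setT by apply: sub; rewrite E set22.
  exists [set i; j]; last by rewrite imsetU1 imset_set1 -xi -yj.
  have : adj (complete 'I_k) i j; last by [].
  by rewrite adj_graph_of_rel orbT andbT; apply: contraNneq nxy => ij;
    rewrite xi yj ij.
rewrite /ncopies -(card_imset (f := fun A => (A, pairs T A)) (cliques G k));
  last by move=> A B [].
congr #|pred_of_set _|; apply/setP => c; apply/imsetP/imsetP.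
  move=> [f]; rewrite inE => /embeddingP[fI fh] ->.
  exists (f @: setT); last by rewrite pairsE.
  rewrite inE card_imset // cardsT card_ord eqxx /=; apply/cliqueP.
  move=> _ _ /imsetP[i _ ->] /imsetP[j _ ->] nij; apply: fh.
  by rewrite adj_graph_of_rel orbT andbT; apply: contraNneq nij => ->.
move=> [A]; rewrite inE => /andP[/eqP cA /cliqueP cl] ->.
pose f := [ffun i : 'I_k => enum_val (cast_ord (esym cA) i)].
have fI : injective f.
  by move=> i j; rewrite !ffunE => /enum_val_inj/cast_ord_inj.
have fA : f @: setT = A.
  apply/eqP; rewrite eqEcard card_imset // cardsT card_ord cA leqnn andbT.
  by apply/subsetP => _ /imsetP[i _ ->]; rewrite ffunE enum_valP.
exists f; last by rewrite pairsE // fA.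
rewrite inE; apply/embeddingP; split=> // i j /adj_neq nij.
by apply: cl; rewrite ?(inj_eq fI) // -fA imset_f.
Qed.

(** * Transport along injections and relabelling of vertices *)

Section Transport.
Variables (U V : finType) (D : sgraph U) (G : sgraph V) (h : U -> V).
Hypotheses (hI : injective h) (hE : forall x y, adj D x y = adj G (h x) (h y)).

(** By [hE] the map [h] identifies [D] with an induced subgraph of [G], so image and preimage under
    [h] match up the cliques. *)
Lemma card_cliques_im k : #|cliques D k| = #|cliques_in G (h @: setT) k|.
Proof.
rewrite -(card_imset _ (imset_inj hI)).
congr #|pred_of_set _|; apply/setP => A; apply/imsetP/idP.
  move=> [B]; rewrite !inE => /andP[cB /cliqueP cl] ->.
  rewrite card_imset // cB imsetS //= andbT; apply/cliqueP.
  move=> _ _ /imsetP[x xB ->] /imsetP[y yB ->]; rewrite -hE => nxy.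
  by apply: cl => //; apply: contraNneq nxy => ->.
rewrite !inE => /andP[/andP[cA /cliqueP cl] /subsetP sub].
have hA : h @: (h @^-1: A) = A.
  apply/setP => x; apply/imsetP/idP => [[y] | xA]; first by rewrite inE => ? ->.
  by have /imsetP[y _ xy] := sub _ xA; exists y; rewrite // inE -xy.
exists (h @^-1: A); last by rewrite hA.
rewrite inE -(card_imset _ hI) hA cA; apply/cliqueP => x y.
by rewrite !inE => xA yA nxy; rewrite hE cl // (inj_eq hI).
Qed.

Lemma contains_sub (S : finType) (H : sgraph S) : contains H D -> contains H G.
Proof.
move/containsP => [f fI fh]; apply/containsP; exists (h \o f).
  exact: inj_comp.
by move=> x y /fh; rewrite hE.
Qed.
End Transport.

(** [ex] and [DF] range over graphs on ordinals only; this makes induced subgraphs, joins and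
    disjoint sums comparable with them. *)
Lemma relabel (U : finType) n (G : sgraph U) : #|U| = n ->
  exists G' : sgraph 'I_n,
    (forall (S : finType) (H : sgraph S), contains H G' = contains H G) /\
    (forall k, #|cliques G' k| = #|cliques G k|).
Proof.
move=> cU; pose h (i : 'I_n) : U := enum_val (cast_ord (esym cU) i).
pose h' (x : U) : 'I_n := cast_ord cU (enum_rank x).
have hK : cancel h h' by move=> i; rewrite /h /h' enum_valK cast_ordKV.
have h'K : cancel h' h by move=> i; rewrite /h /h' cast_ordK enum_rankK.
pose G' : sgraph 'I_n := graph_of_rel (fun i j => adj G (h i) (h j)).
have hE i j : adj G' i j = adj G (h i) (h j).
  rewrite adj_graph_of_rel (adj_sym G (h j)) orbb andb_idl // => /adj_neq.
  by apply: contraNneq => ->.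
exists G'; split=> [S H | k].
  apply/idP/idP; first exact: (contains_sub (can_inj hK) hE).
  by apply: (contains_sub (can_inj h'K)) => x y; rewrite hE !h'K.
rewrite (card_cliques_im (can_inj hK) hE) -cliques_inT.
have -> : h @: setT = setT; last by [].
apply/setP => x; rewrite inE.
by apply/imsetP; exists (h' x); rewrite ?h'K.
Qed.

Lemma free_congr (Fs : Defs.family) (U V : finType) (G : sgraph U) (G' : sgraph V) :
  (forall (S : finType) (H : sgraph S), contains H G' = contains H G) ->
  free Fs G' = free Fs G.
Proof. by move=> h; apply: eq_all => H; rewrite h. Qed.

Lemma leq_ex (U : finType) (G : sgraph U) n k (Fs : Defs.family) :
  #|U| = n -> free Fs G -> #|cliques G k| <= ex n (complete 'I_k) Fs.
Proof.
move=> cU fG; have [G' [cont <-]] := relabel G cU.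
by rewrite -ncopies_complete; apply: leq_bigmax_cond; rewrite (free_congr _ cont).
Qed.

(** * Neighbourhoods and elementary clique counting *)

Definition nbr (T : finType) (G : sgraph T) (v : T) : {set T} :=
  [set u | adj G v u].

Lemma cliques_del (T : finType) (G : sgraph T) k (A : {set T}) v :
  A \in cliques G k.+1 -> v \in A -> A :\ v \in cliques_in G (nbr G v) k.
Proof.
rewrite !inE => /andP[/eqP cA clA] vA; rewrite (clique_sub (subsetDl _ _) clA).
move: cA; rewrite (cardsD1 v) vA add1n => -[->]; rewrite eqxx /=.
apply/subsetP => u; rewrite !inE => /andP[nuv uA].
by move/cliqueP: clA; apply; rewrite // eq_sym.
Qed.

Lemma cliques_add (T : finType) (G : sgraph T) k (B : {set T}) v :
  B \in cliques_in G (nbr G v) k -> v |: B \in cliques G k.+1.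
Proof.
rewrite !inE => /andP[/andP[/eqP cB /cliqueP clB] /subsetP sub].
have vB : v \notin B by apply/negP => /sub; rewrite inE adj_irr.
rewrite cardsU1 vB cB eqxx; apply/cliqueP => x y.
move=> /setU1P[-> | xB] /setU1P[-> | yB]; rewrite ?eqxx // => nxy.
- by have := sub _ yB; rewrite inE.
- by have := sub _ xB; rewrite inE adj_sym.
- exact: clB.
Qed.

Lemma leq_card_bigcup (I T : finType) (P : pred I) (B : I -> {set T}) :
  #|\bigcup_(i | P i) B i| <= \sum_(i | P i) #|B i|.
Proof.
elim/big_rec2: _ => [|i m A _ le]; first by rewrite cards0.
by rewrite (leq_trans (leq_card_setU _ _)) // leq_add2l.
Qed.

Lemma inj_on (T U : finType) (B : {set T}) (X : {set U}) :
  #|B| <= #|X| -> 0 < #|X| ->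
  exists g : T -> U, {in B, forall x, g x \in X} /\ {in B &, injective g}.
Proof.
(* The i-th element of [B] is sent to the i-th element of [X]; [u0] is only the default value of
   [nth]. *)
move=> le /card_gt0P[u0 u0X]; exists (fun x => nth u0 (enum X) (index x (enum B))).
have lt x : x \in B -> index x (enum B) < size (enum X).
  move=> xB; apply: leq_trans (_ : #|B| <= _); last by rewrite -cardE.
  by rewrite cardE index_mem mem_enum.
split=> [x xB | x y xB yB]; first by rewrite -mem_enum mem_nth // lt.
move/eqP; rewrite nth_uniq ?enum_uniq ?lt // => /eqP.
by apply: (index_inj x); rewrite mem_enum.
Qed.

(** Enumerating a k-clique exhibits it as the image of a function from ['I_k]. *)
Lemma card_cliques_le (T : finType) (G : sgraph T) k :
  #|cliques G k| <= #|T| ^ k.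
Proof.
rewrite -[k in X in _ <= X]card_ord -card_ffun.
apply: leq_trans (leq_imset_card (fun f : {ffun 'I_k -> T} => f @: setT) _).
apply/subset_leq_card/subsetP => A; rewrite inE => /andP[/eqP cA _].
pose f := [ffun i : 'I_k => enum_val (cast_ord (esym cA) i)].
have fI : injective f.
  by move=> i j; rewrite !ffunE => /enum_val_inj/cast_ord_inj.
apply/imsetP; exists f => //; apply/esym/eqP.
rewrite eqEcard card_imset // cardsT card_ord cA leqnn andbT.
by apply/subsetP => _ /imsetP[i _ ->]; rewrite ffunE enum_valP.
Qed.

(** * Chromatic number and the deletion family *)

Lemma chromatic_number_le (T : finType) (F : sgraph T) k (c : T -> 'I_k) :
  (forall x y, adj F x y -> c x != c y) -> chromatic_number F <= k.
Proof.
move=> h; rewrite /chromatic_number; case: ex_minnP => m _; apply.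
apply/existsP; exists [ffun x => c x]; apply/forallP => x; apply/forallP => y.
by apply/implyP; rewrite !ffunE; apply: h.
Qed.

(** An empty vertex set can be coloured with no colours at all. *)
Lemma chromatic_gt0 (T : finType) (F : sgraph T) :
  0 < chromatic_number F -> 0 < #|T|.
Proof.
apply: contraTT; rewrite -!leqNgt leqn0 => /eqP T0.
have no (x : T) : False by have := card0_eq T0 x.
by apply: (chromatic_number_le (c := fun x => False_rect 'I_0 (no x))) => x.
Qed.

(* A total map into [option U] encodes an independent set (the fibre of [None])
   together with a copy in D of the graph left after deleting it. *)
Definition deletion_map (T U : finType) (F : sgraph T) (D : sgraph U)
    (f : T -> option U) : Prop :=
  (forall x y, adj F x y ->
     match f x, f y return Prop with
     | Some u, Some v => adj D u v
     | None, None => False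
     | _, _ => True
     end) /\
  (forall x y u, f x = Some u -> f y = Some u -> x = y).

Lemma deletion_freeP (T U : finType) (F : sgraph T) (D : sgraph U) :
  free (deletion_family F) D <-> forall f, ~ deletion_map F D f.
Proof.
rewrite /free /deletion_family all_map; split=> [/allP fr f [fh fI] | h].
  pose A := [set x | f x == None].
  have Ai : A \in [set B | independent F B].
    rewrite inE; apply/forall_inP => x; rewrite inE => /eqP fx.
    apply/forall_inP => y; rewrite inE => /eqP fy.
    by apply/negP => /fh; rewrite fx fy.
  have := fr A; rewrite mem_enum => /(_ Ai) /= /negP; apply.
  have gP (x : {x | x \in ~: A}) : exists u, f (val x) == Some u.
    have := valP x; rewrite !inE; case: (f _) => // u _.
    by exists u.
  have [g fE] : exists g : {x | x \in ~: A} -> U, forall x, f (val x) = Some (g x).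
    by exists (fun x => xchoose (gP x)) => x; apply/eqP; apply: (xchooseP (gP x)).
  apply/containsP; exists g => [x y E | x y].
    by apply/val_inj/(fI _ _ (g x)); rewrite fE ?E.
  rewrite adj_graph_of_rel (adj_sym _ (val y)) orbb => /andP[_ /fh].
  by rewrite !fE.
apply/allP => A; rewrite mem_enum inE => /forall_inP Ai /=.
apply/negP => /containsP[f fI fh].
(* [insub x] fails exactly when [x] lies in the deleted set [A], so [A] becomes the fibre of
   [None]. *)
apply: (h (fun x => omap f (insub x : option {x | x \in ~: A}))).
split=> [x y | x y u].
  case: insubP => [x' _ xE | xA]; case: insubP => [y' _ yE | yA] //= xy.
    apply: fh; rewrite adj_graph_of_rel xE yE xy andbT.
    by apply: contraTneq xy => E; rewrite -xE -yE E adj_irr.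
  move: xA yA; rewrite !inE !negbK => xA yA.
  by have /forall_inP/(_ y yA) := Ai x xA; rewrite xy.
case: insubP => [x' _ <-|] //= [<-]; case: insubP => [y' _ <-|] //= [/fI ->].
by [].
Qed.

(** * A Turan-type lower bound for the deletion family *)

Section Turan.
Variables (s k : nat).

(** The classes are the residues modulo [k.+1]: this is the balanced complete (k+1)-partite
    graph. *)
Definition turan : sgraph 'I_s :=
  graph_of_rel (fun i j : 'I_s => i %% k.+1 != j %% k.+1).

Lemma adj_turan i j : adj turan i j = (i %% k.+1 != j %% k.+1).
Proof.
rewrite adj_graph_of_rel (eq_sym (j %% _)) orbb andb_idl //.
by apply: contraNneq => ->.
Qed.

(** If deleting an independent set of [F] left a subgraph of this (k+1)-colourable graph, one extra
    colour for the deleted set would colour [F] with k + 2 colours. *)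
Lemma turan_deletion_free (T : finType) (F : sgraph T) :
  k.+2 < chromatic_number F -> free (deletion_family F) turan.
Proof.
move=> hF; apply/deletion_freeP => f [fh fI]; move: hF; apply/negP.
rewrite -leqNgt; pose c x : 'I_k.+2 :=
  if f x is Some u then inord (u %% k.+1) else ord_max.
have lt (u : 'I_s) : u %% k.+1 < k.+1 by rewrite ltn_mod.
have lt2 (u : 'I_s) : u %% k.+1 < k.+2 by apply: ltnW; apply: lt.
apply: (chromatic_number_le (c := c)) => x y /fh; rewrite /c.
case: (f x) => [u|]; case: (f y) => [v|] //.
- by rewrite adj_turan; apply: contraNneq => /(congr1 val);
    rewrite /= !inordK ?lt2 // => ->.
- move=> _; apply/eqP => /(congr1 val) /=; rewrite inordK ?lt2 //.
  by have := lt u; lia.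
- move=> _; apply/eqP => /(congr1 val) /=; rewrite inordK ?lt2 //.
  by have := lt v; lia.
Qed.

(** Each residue class has at least [q] vertices, and picking one vertex per class always gives a
    clique; [f j * k.+1 + j] is the vertex picked in class [j]. *)
Lemma card_cliques_turan : (s %/ k.+1) ^ k.+1 <= #|cliques turan k.+1|.
Proof.
set q := s %/ k.+1.
have lt (f : {ffun 'I_k.+1 -> 'I_q}) j : f j * k.+1 + j < s.
  have := leq_divM s k.+1; rewrite -/q.
  by have := ltn_ord (f j); have := ltn_ord j; nia.
pose g (f : {ffun 'I_k.+1 -> 'I_q}) j := Ordinal (lt f j).
have gm f j : g f j %% k.+1 = j by rewrite /= modnMDl modn_small.
have gd f j : g f j %/ k.+1 = f j by rewrite /= divnMDl // divn_small // addn0.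
have gI f : injective (g f).
  by move=> i j E; apply: val_inj; rewrite /= -(gm f i) E gm.
rewrite -[q]card_ord -[k.+1 in X in X <= _]card_ord -card_ffun.
rewrite -(card_imset (f := fun f : {ffun 'I_k.+1 -> 'I_q} => g f @: setT)).
  apply/subset_leq_card/subsetP => _ /imsetP[f _ ->].
  rewrite inE card_imset // cardsT card_ord eqxx /=; apply/cliqueP.
  move=> _ _ /imsetP[i _ ->] /imsetP[j _ ->] nij; rewrite adj_turan !gm.
  by apply: contraNneq nij => /val_inj ->.
move=> f f' E; apply/ffunP => j; apply: val_inj; rewrite /= -(gd f) -(gd f').
have : g f j \in g f' @: setT by rewrite -E imset_f.
case/imsetP => j' _ E'; rewrite E'; suff -> : j' = j by [].
by apply: val_inj; have := gm f j; rewrite E' gm.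
Qed.
End Turan.

Lemma leq_wexp2r e a b : a <= b -> a ^ e <= b ^ e.
Proof. by case: e => [|e] ab; rewrite ?expn0 ?leq_exp2r. Qed.

(** The Turan-type graph has a number of cliques of order s^(k+1), which outgrows the s^k on the
    left. *)
Lemma ex_deletion_large (T : finType) (F : sgraph T) k :
  k.+2 < chromatic_number F ->
  exists s0, forall s, s0 <= s ->
    #|T| * s ^ k < ex s (complete 'I_k.+1) (deletion_family F).
Proof.
(* With q = s / (k+1) one has s <= 2(k+1)q, so s^k costs a factor (2(k+1))^k over q^k; the threshold
   makes [q] exceed [#|T|] times this factor. *)
move=> hF; exists (k.+1 * (#|T| * (2 * k.+1) ^ k).+1) => s hs.
have := leq_ex k.+1 (card_ord s) (turan_deletion_free s hF).
apply: leq_trans; apply: leq_trans (card_cliques_turan s k).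
set q := s %/ k.+1.
have qge : #|T| * (2 * k.+1) ^ k < q by rewrite leq_divRL // mulnC.
have sle : s <= 2 * k.+1 * q.
  by have := ltn_ceil s (ltn0Sn k); rewrite -/q; nia.
have := leq_wexp2r k sle; rewrite expnMn => /(leq_mul (leqnn #|T|)) le.
apply: leq_ltn_trans le _; rewrite mulnA expnS ltn_mul2r qge andbT expn_gt0.
by rewrite (leq_ltn_trans _ qge).
Qed.

(** * Fewer than s vertices cannot attain the extremal number *)

Definition common_nbrs (T : finType) (G : sgraph T) (Q : {set T}) : {set T} :=
  [set v | Q \subset nbr G v].

(** Averaging: there are at most [#|U| ^ k] cliques of size k, and if each had fewer than [c] common
    neighbours, they would extend to too few (k+1)-cliques. *)
Lemma ex_clique_many_common_nbrs (U : finType) (D : sgraph U) k c :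
  c * #|U| ^ k < #|cliques D k.+1| ->
  exists2 Q, Q \in cliques D k & c <= #|common_nbrs D Q|.
Proof.
move=> big.
case: (boolP [exists Q in cliques D k, c <= #|common_nbrs D Q|]) => [|no].
  by case/exists_inP => Q QD cQ; exists Q.
suff : #|cliques D k.+1| <= c * #|U| ^ k by rewrite leqNgt big.
apply: leq_trans (_ : c * #|cliques D k| <= _); last first.
  by rewrite leq_mul2l card_cliques_le orbT.
rewrite mulnC -sum_nat_const.
pose add Q := [set v |: Q | v in common_nbrs D Q].
apply: leq_trans (_ : \sum_(Q in cliques D k) #|add Q| <= _); last first.
  apply: leq_sum => Q QD; apply: leq_trans (leq_imset_card _ _) _.
  by apply: contraNT no; rewrite -ltnNge => /ltnW h; apply/exists_inP; exists Q.
apply: leq_trans (leq_card_bigcup _ _); apply/subset_leq_card/subsetP => A AD.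
have [v vA] : exists v, v \in A.
  by apply/card_gt0P; move: AD; rewrite inE => /andP[/eqP ->].
have := cliques_del AD vA; rewrite inE => /andP[BD sub].
by apply/bigcupP; exists (A :\ v) => //; apply/imsetP; exists v;
  rewrite ?inE // setD1K.
Qed.

Section AttachTwins.
Variables (U : finType) (D : sgraph U) (Q : {set U}) (t : nat).

(** The [t] new vertices are pairwise non-adjacent and each has neighbourhood exactly [Q]. *)
Definition attach : sgraph (U + 'I_t)%type :=
  graph_of_rel (fun a b => match a, b with
    | inl x, inl y => adj D x y
    | inl x, inr _ | inr _, inl x => x \in Q
    | inr _, inr _ => false
    end).

Lemma adj_attach a b :
  adj attach a b = match a, b with
    | inl x, inl y => adj D x y
    | inl x, inr _ | inr _, inl x => x \in Q
    | inr _, inr _ => false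
    end.
Proof.
rewrite adj_graph_of_rel; case: a b => [x|i] [y|j] //=; last by rewrite andbF.
- rewrite (adj_sym D y) orbb andb_idl // => /adj_neq.
  by apply: contraNneq => -[->].
- by rewrite orbb.
- by rewrite orbb.
Qed.

(* A copy of a deleted graph using few attached vertices can be pushed back into
   D, since every common neighbour of Q can play the role of a new vertex. *)
Lemma attach_deletion_free (T : finType) (F : sgraph T) :
  0 < #|T| -> #|T| <= #|common_nbrs D Q| ->
  free (deletion_family F) D -> free (deletion_family F) attach.
Proof.
move=> T0 cT /deletion_freeP fr; apply/deletion_freeP => f [fh fI].
(* [B] holds the vertices of [F] placed on new vertices, [used] the vertices of [D] already
   occupied. *)
pose B := [set x | if f x is Some (inr _) then true else false].
pose used := [set u | [exists x, f x == Some (inl u)]].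
have used_le : #|used| <= #|~: B|.
  have [g gP] : exists g : U -> T, {in used, forall u, f (g u) = Some (inl u)}.
    have /card_gt0P[x0 _] := T0.
    exists (fun u => odflt x0 [pick x | f x == Some (inl u)]) => u.
    rewrite inE; case: pickP => [x /eqP //|no] /existsP[x].
    by rewrite no.
  rewrite -(card_in_imset (f := g) (D := used)).
    apply/subset_leq_card/subsetP => _ /imsetP[u uu ->].
    by rewrite !inE gP.
  by move=> u v uu vu E; have := gP u uu; rewrite E gP // => -[].
(* Choosing a preimage for each used vertex gives [#|used| <= #|T| - #|B|], so at least [#|B|]
   common neighbours of [Q] are still free. *)
have XB : #|B| <= #|common_nbrs D Q :\: used|.
  have := cardsC B; have := cardsID used (common_nbrs D Q).
  have := subset_leq_card (subsetIr (common_nbrs D Q) used).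
  move: used_le cT; lia.
(* If [B] is empty, [f] already lands in [D]; otherwise the set of free common neighbours is
   nonempty, as [inj_on] requires. *)
have [B0 | B0] := posnP #|B|.
  pose f' x := if f x is Some (inl u) then Some u else None.
  have fB x : f x = omap inl (f' x).
    have := card0_eq B0 x; rewrite inE /f'; case: (f x) => [[]|] //.
  apply: (fr f'); split=> [x y /fh | x y u fx fy]; last first.
    by apply: (fI _ _ (inl u)); rewrite fB ?fx ?fy.
  by rewrite !fB; case: (f' x) => [u|]; case: (f' y) => [v|] //=; rewrite adj_attach.
have [g [gX gI]] := inj_on XB (leq_trans B0 XB).
have gN x : x \in B -> g x \in common_nbrs D Q.
  by move/gX; rewrite inE => /andP[].
have gU x y : x \in B -> f y = Some (inl (g x)) -> False.
  move/gX; rewrite inE => /andP[+ _] fy; rewrite inE => /existsP; apply.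
  by exists y; apply/eqP.
pose f' x := match f x with
  | Some (inl u) => Some u | Some (inr _) => Some (g x) | None => None end.
have inB x i : f x = Some (inr i) -> x \in B by move=> fx; rewrite inE fx.
have adjg x u : x \in B -> u \in Q -> adj D (g x) u.
  by move=> /gN; rewrite inE => /subsetP sub /sub; rewrite inE.
apply: (fr f'); split=> [x y /fh | x y u]; rewrite /f'.
  case fx: (f x) => [[u|i]|]; case fy: (f y) => [[v|j]|] //; rewrite adj_attach //.
    by move=> uQ; rewrite adj_sym adjg // (inB _ _ fy).
  by move=> vQ; rewrite adjg // (inB _ _ fx).
case fx: (f x) => [[v|i]|] //; case fy: (f y) => [[w|j]|] // [Ex] [Ey].
- by apply: fI fx _; rewrite fy Ex Ey.
- by case: (gU y x (inB _ _ fy)); rewrite fx Ex Ey.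
- by case: (gU x y (inB _ _ fx)); rewrite fy Ex Ey.
- by apply: gI; rewrite ?(inB _ _ fx) ?(inB _ _ fy) // Ex Ey.
Qed.

(** All old cliques survive, and [Q] with one new vertex is a further one. *)
Lemma card_cliques_attach k : 0 < t -> Q \in cliques D k ->
  #|cliques D k.+1| < #|cliques attach k.+1|.
Proof.
move=> t0; rewrite inE => /andP[/eqP cQ /cliqueP clQ].
have inlI : injective (@inl U 'I_t) by move=> x y [].
have inlE x y : adj D x y = adj attach (inl x) (inl y) by rewrite adj_attach.
rewrite (card_cliques_im inlI inlE); apply: proper_card.
rewrite properE; apply/andP; split; first by apply/subsetP => A; rewrite inE => /andP[].
apply/subsetPn; exists (inr (Ordinal t0) |: inl @: Q); last first.
  rewrite inE negb_and; apply/orP; right; apply/subsetPn.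
  exists (inr (Ordinal t0)); first exact: setU11.
  by apply/imsetP => -[].
apply: cliques_add; rewrite !inE card_imset // cQ eqxx /=; apply/andP; split.
  apply/cliqueP => _ _ /imsetP[x xQ ->] /imsetP[y yQ ->] nxy.
  by rewrite -inlE clQ //; apply: contraNneq nxy => ->.
by apply/subsetP => _ /imsetP[x xQ ->]; rewrite inE adj_attach.
Qed.
End AttachTwins.

(** Otherwise [D] has a k-clique with [#|T|] common neighbours, and attaching the [s - #|U|] missing
    vertices to it yields a deletion-free graph on s vertices that beats the maximum. *)
Lemma cliques_lt_ex (T : finType) (F : sgraph T) (U : finType) (D : sgraph U)
    k s :
  0 < #|T| -> #|U| < s ->
  #|T| * s ^ k < ex s (complete 'I_k.+1) (deletion_family F) ->
  free (deletion_family F) D ->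
  #|cliques D k.+1| < ex s (complete 'I_k.+1) (deletion_family F).
Proof.
move=> T0 Us big fr; rewrite ltnNge; apply/negP => le.
have [|Q QD cQ] := @ex_clique_many_common_nbrs U D k #|T|.
  apply: leq_ltn_trans (leq_trans big le).
  by rewrite leq_mul2l leq_wexp2r ?orbT // ltnW.
have frA := attach_deletion_free (s - #|U|) T0 cQ fr.
have cA : #|{: U + 'I_(s - #|U|)}| = s.
  by rewrite card_sum card_ord subnKC // ltnW.
have := leq_ex k.+1 cA frA; rewrite leqNgt => /negP; apply.
by apply: leq_ltn_trans le _; apply: card_cliques_attach; rewrite ?subn_gt0.
Qed.

(** * Matchings and vertex covers *)

Section Matchings.
Variables (V : finType) (G : sgraph V).
Implicit Types p : seq (V * V).

(** Concatenating the two lists of endpoints makes one [uniq] test express that all endpoints are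
    distinct. *)
Definition is_matching p : bool :=
  uniq (unzip1 p ++ unzip2 p) && all (fun e => adj G e.1 e.2) p.

Lemma contains_matching p : is_matching p -> contains (matching (size p)) G.
Proof.
case/andP => un ad; set m := size p.
have sz : size (unzip1 p ++ unzip2 p) = m + m by rewrite size_cat !size_map.
case: (posnP m) => [m0 | mgt].
  have no (x : 'I_m * bool) : False by case: x => -[i]; rewrite m0.
  apply/containsP; exists (fun x => False_rect V (no x)); first by move=> x.
  by move=> x.
have [x0 _] : exists x0 : V, true.
  by move: mgt; rewrite /m; case: (p) => // -[x0 _] _ _; exists x0.
(* First endpoints occupy positions 0 to m - 1 of the concatenated list, second endpoints positions
   m to 2m - 1. *)
pose idx (x : 'I_m * bool) := x.1 + x.2 * m.
have idx_lt x : idx x < m + m.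
  by rewrite /idx; case: x => i [] /=; have := ltn_ord i; lia.
have idxI : injective idx.
  move=> [i b] [j c]; rewrite /idx /= => E.
  have hi := ltn_ord i; have hj := ltn_ord j.
  have ebc : b = c by case: b c E => -[]; lia.
  by subst c; congr (_, _); apply: val_inj => /=; lia.
pose f x := nth x0 (unzip1 p ++ unzip2 p) (idx x).
have fE (i : 'I_m) : adj G (f (i, false)) (f (i, true)).
  rewrite /f /idx /= mul0n addn0 mul1n !nth_cat !size_map ltn_ord.
  rewrite ltnNge leq_addl /= addnK (nth_map (x0, x0)) // (nth_map (x0, x0)) //.
  by move/all_nthP: ad; apply.
apply/containsP; exists f => [x y /eqP | [i b] [j c]].
  by rewrite nth_uniq ?sz // => /eqP/idxI.
rewrite adj_graph_of_rel /= (eq_sym j) orbb => /andP[+ /eqP ij]; subst j.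
by case: b c => -[]; rewrite ?eqxx // => _; rewrite ?fE // adj_sym fE.
Qed.

Lemma bipartite_matching (A X : {set V}) m :
  [disjoint A & X] -> {in A & X, forall a x, adj G a x} ->
  m <= #|A| -> m <= #|X| ->
  exists p, [/\ size p = m, is_matching p,
    {subset unzip1 p <= A} & {subset unzip2 p <= X}].
Proof.
move=> dAX ad mA mX; pose a := take m (enum A); pose x := take m (enum X).
have sa : size a = m by rewrite size_takel // -cardE.
have sx : size x = m by rewrite size_takel // -cardE.
have aA : {subset a <= A} by move=> v /mem_take; rewrite mem_enum.
have xX : {subset x <= X} by move=> v /mem_take; rewrite mem_enum.
exists (zip a x); rewrite /is_matching unzip1_zip ?unzip2_zip ?sa ?sx //.
rewrite size_zip sa sx minnn; split=> //; apply/andP; split.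
  rewrite cat_uniq !take_uniq ?enum_uniq // andbT /=; apply/hasPn => v /xX vX.
  by apply/negP => /aA vA; rewrite (disjointFr dAX vA) in vX.
apply/allP => e ez; apply: ad.
  by apply: aA; rewrite -(unzip1_zip (s := a) (t := x)) ?sa ?sx // map_f.
by apply: xX; rewrite -(unzip2_zip (s := a) (t := x)) ?sa ?sx // map_f.
Qed.

(** A matching is grown greedily; when it cannot be extended, its at most 2m endpoints meet every
    edge. *)
Lemma small_vertex_cover m : ~~ contains (matching m.+1) G ->
  exists2 W : {set V}, #|W| <= 2 * m
    & forall x y, adj G x y -> (x \in W) || (y \in W).
Proof.
move=> no.
suff grow l : l <= m.+1 -> (exists p, size p = l /\ is_matching p) \/
    exists2 W : {set V}, #|W| <= 2 * m
      & forall x y, adj G x y -> (x \in W) || (y \in W).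
  have [[p [sp mp]] | //] := grow _ (leqnn _).
  by move: no; rewrite -sp (contains_matching mp).
elim: l => [|l IH] lm; first by left; exists [::].
have [[p [sp mp]] | //] := IH (ltnW lm); last by right.
pose W := [set x in unzip1 p ++ unzip2 p].
have cW : #|W| <= 2 * m.
  rewrite cardsE; apply: leq_trans (card_size _) _.
  by rewrite size_cat !size_map sp; lia.
have [/forallP cov | ] := boolP [forall x, forall y,
    adj G x y ==> (x \in W) || (y \in W)].
  by right; exists W => // x y; have /forallP/(_ y)/implyP := cov x.
rewrite negb_forall => /existsP[x]; rewrite negb_forall => /existsP[y].
rewrite negb_imply negb_or !inE !mem_cat !negb_or.
move=> /and3P[xy /andP[x1 x2] /andP[y1 y2]].
left; exists ((x, y) :: p); rewrite /= sp; split=> //.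
case/andP: mp => un ad; rewrite /is_matching /= xy ad andbT.
rewrite mem_cat inE !negb_or x1 x2 (adj_neq xy) /=.
by rewrite uniq_catC /= mem_cat negb_or y1 y2 uniq_catC un.
Qed.
End Matchings.

(** * Induced subgraphs, and clique counts relative to a vertex cover *)

Section Induced.
Variables (V : finType) (G : sgraph V) (S : {set V}).

Lemma adj_induced x y : adj (induced G S) x y = adj G (val x) (val y).
Proof.
rewrite adj_graph_of_rel (adj_sym G (val y)) orbb andb_idl // => /adj_neq.
by apply: contraNneq => ->.
Qed.

Lemma card_cliques_induced k : #|cliques (induced G S) k| = #|cliques_in G S k|.
Proof.
rewrite (card_cliques_im val_inj adj_induced).
suff -> : [set val x | x in [set: {x | x \in S}]] = S by [].
apply/setP => x; apply/imsetP/idP => [[y _ ->] | xS]; first exact: valP.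
by exists (Sub x xS).
Qed.

(** A copy in [S] of [F] minus an independent set extends to a copy of [F]: [X] has room for the
    deleted vertices and is completely joined to [S]. *)
Lemma induced_deletion_free (T : finType) (F : sgraph T) (X : {set V}) :
  ~~ contains F G -> [disjoint S & X] ->
  {in S & X, forall a x, adj G a x} -> 0 < #|T| -> #|T| <= #|X| ->
  free (deletion_family F) (induced G S).
Proof.
move=> noF dSX ad T0 TX; apply/deletion_freeP => f [fh fI]; case/negP: noF.
pose B := [set x | f x == None].
have [g [gX gI]] := inj_on (leq_trans (max_card (mem B)) TX) (leq_trans T0 TX).
have inB x : f x = None -> x \in B by move=> fx; rewrite inE fx.
have adSX (u : {x | x \in S}) y : f y = None -> adj G (val u) (g y).
  by move=> fy; apply: ad; [apply: valP | apply/gX/inB].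
apply/containsP; exists (fun x => if f x is Some u then val u else g x).
  move=> x y; case fx: (f x) => [u|]; case fy: (f y) => [v|] E.
  - by apply: fI fx _; rewrite fy; congr Some; apply: val_inj.
  - by have := adSX u y fy; rewrite E adj_irr.
  - by have := adSX v x fx; rewrite E adj_irr.
  - by apply: gI; rewrite ?inB.
move=> x y /fh; case fx: (f x) => [u|]; case fy: (f y) => [v|] //.
- by rewrite adj_induced.
- by move=> _; apply: adSX.
- by move=> _; rewrite adj_sym; apply: adSX.
Qed.
End Induced.

(** A clique not contained in [W] is charged to one of its vertices outside [W]. *)
Lemma card_cliques_split (V : finType) (G : sgraph V) (W : {set V}) k :
  #|cliques G k.+1| <= #|cliques_in G W k.+1|
                       + \sum_(v in ~: W) #|cliques_in G (nbr G v) k|.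
Proof.
pose add v := [set v |: B | B in cliques_in G (nbr G v) k].
apply: leq_trans
    (_ : #|cliques_in G W k.+1| + \sum_(v in ~: W) #|add v| <= _);
  last by rewrite leq_add2l leq_sum // => v _; apply: leq_imset_card.
set X := cliques_in G W k.+1; set Y := \bigcup_(v in ~: W) add v.
apply: leq_trans (_ : #|X :|: Y| <= _); last first.
  apply: leq_trans (leq_card_setU X Y).1 _.
  by rewrite leq_add2l leq_card_bigcup.
apply/subset_leq_card/subsetP => A AG; rewrite inE.
have [AW | /subsetPn[v vA vW]] := boolP (A \subset W).
  by rewrite inE AG AW.
apply/orP; right; apply/bigcupP; exists v; first by rewrite inE.
by apply/imsetP; exists (A :\ v); rewrite ?cliques_del // setD1K.
Qed.

Section VertexCover.
Variables (V : finType) (G : sgraph V) (W : {set V}).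
Hypothesis cov : forall x y, adj G x y -> (x \in W) || (y \in W).

Lemma nbr_cover v : v \notin W -> nbr G v \subset W.
Proof.
by move=> vW; apply/subsetP => u; rewrite inE => /cov; rewrite (negPf vW).
Qed.

Definition twins v : {set V} := [set u in ~: W | nbr G u == nbr G v].

(** Vertices outside [W] are grouped by neighbourhood, a subset of [W]; a class containing a vertex
    with fewer than [c] twins has fewer than [c] members. *)
Lemma card_few_twins c :
  #|[set v in ~: W | #|twins v| < c]| <= 2 ^ #|W| * c.
Proof.
rewrite -card_powerset -sum_nat_const.
pose B S := [set v in ~: W | (#|twins v| < c) && (nbr G v == S)].
apply: leq_trans (_ : \sum_(S in powerset W) #|B S| <= _).
  apply: leq_trans (leq_card_bigcup _ _).
  apply/subset_leq_card/subsetP => v; rewrite !inE => /andP[vW vc].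
  apply/bigcupP; exists (nbr G v); first by rewrite inE nbr_cover.
  by rewrite !inE vW vc eqxx.
apply: leq_sum => S _; have [->|/set0Pn[v]] := eqVneq (B S) set0.
  by rewrite cards0.
rewrite !inE => /and3P[vW vc /eqP vS]; apply: leq_trans (ltnW vc).
apply/subset_leq_card/subsetP => u; rewrite !inE => /and3P[-> _ /eqP->].
by rewrite vS eqxx.
Qed.

Lemma disjoint_nbr_twins v : v \notin W -> [disjoint nbr G v & twins v].
Proof.
move=> vW; rewrite disjoints_subset; apply: subset_trans (nbr_cover vW) _.
by apply/subsetP => u uW; rewrite !inE uW.
Qed.

Lemma adj_nbr_twins v : {in nbr G v & twins v, forall a x, adj G a x}.
Proof.
move=> a x av; rewrite inE => /andP[_ /eqP xv].
by rewrite adj_sym; have := av; rewrite -xv inE.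
Qed.
End VertexCover.

(** An edge xy avoiding [S], together with a matching of [S] into [X] without x and y, would have
    [#|S|.+1] edges; the two vertices to be avoided explain [#|S|.+2]. *)
Lemma full_nbr_cover (V : finType) (G : sgraph V) (S X : {set V}) :
  ~~ contains (matching #|S|.+1) G -> [disjoint S & X] ->
  {in S & X, forall a x, adj G a x} -> #|S|.+2 <= #|X| ->
  forall x y, adj G x y -> (x \in S) || (y \in S).
Proof.
move=> noM dSX ad SX x y xy; apply: contraNT noM; rewrite negb_or.
move=> /andP[xS yS]; pose X' := X :\ x :\ y.
have X'X u : u \in X' -> [/\ u != x, u != y & u \in X].
  by rewrite !inE => /and3P[-> -> ->].
have [||||p [sp mp pS pX]] := @bipartite_matching _ G S X' #|S|.
- apply/pred0P => u /=; apply/negP => /andP[uS /X'X[_ _ uX]].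
  by rewrite (disjointFr dSX uS) in uX.
- by move=> a u aS /X'X[_ _ uX]; apply: ad.
- by [].
- have := cardsD1 x X; have := cardsD1 y (X :\ x); rewrite -/X'.
  by move: SX; do 2!case: (_ \in _); lia.
have -> : #|S|.+1 = size ((x, y) :: p) by rewrite /= sp.
apply: contains_matching; case/andP: mp => un al.
rewrite /is_matching /= xy al andbT mem_cat inE !negb_or (adj_neq xy) /=.
have out1 u : u \notin S -> u \notin unzip1 p by apply: contra => /pS.
have x2 : x \notin unzip2 p by apply/negP => /pX/X'X[]; rewrite eqxx.
have y2 : y \notin unzip2 p by apply/negP => /pX/X'X[_]; rewrite eqxx.
by rewrite uniq_catC /= mem_cat negb_or x2 y2 !out1 // uniq_catC un.
Qed.

(** * The upper bound, with r = k + 2 *)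

Section UpperBound.
Variables (T : finType) (F : sgraph T) (s k : nat) (D : sgraph 'I_s).
Hypotheses (T0 : 0 < #|T|) (DFD : D \in DF F s k.+2).
Let m := ex s (complete 'I_k.+1) (deletion_family F).
Hypothesis m_large : #|T| * s ^ k < m.

Lemma DF_free : free (deletion_family F) D.
Proof. by move: DFD; rewrite !inE => /andP[/andP[]]. Qed.

Lemma DF_card : #|cliques D k.+1| = m.
Proof.
move: DFD; rewrite !inE subn1 => /andP[/andP[_ /eqP]].
by rewrite ncopies_complete.
Qed.

Lemma DF_max (U : finType) (D' : sgraph U) : #|U| = s ->
  free (deletion_family F) D' -> #|cliques D' k.+1| = m ->
  #|cliques D' k.+2| <= #|cliques D k.+2|.
Proof.
move=> cU fr cm; have [D'' [cont cl]] := relabel D' cU.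
move: DFD; rewrite inE => /andP[_ /forall_inP/(_ D'')].
rewrite !ncopies_complete cl; apply.
by rewrite inE (free_congr _ cont) fr subn1 ncopies_complete cl cm eqxx.
Qed.

(** So many twins can host any deleted independent set ([#|T|]) and leave [s] of them after two are
    discarded ([s.+2]). *)
Let c := #|T| + s.+2.

(** The summands required of [#|V|] pay, in order, for the cliques inside the cover [W], those
    through vertices with few twins, the difference between [#|V| * m] and [(#|V| - s) * m], and the
    cliques inside [S] when [G[S]] is not extremal. *)
Lemma cliques_le (V : finType) (G : sgraph V) :
  2 ^ (2 * s) + 2 ^ (2 * s) * c * 2 ^ (2 * s) + s * m + 2 ^ s <= #|V| ->
  ~~ contains F G -> ~~ contains (matching s.+1) G ->
  #|cliques G k.+2| <= #|cliques D k.+2| + (#|V| - s) * m.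
Proof.
move=> Vlarge noF noM; have [W cW cov] := small_vertex_cover noM.
have m0 : 0 < m by apply: leq_ltn_trans m_large.
have W2 : 2 ^ #|W| <= 2 ^ (2 * s) by rewrite leq_exp2l.
have rich v : v \in ~: W -> c <= #|twins G W v| ->
    #|nbr G v| <= s /\ free (deletion_family F) (induced G (nbr G v)).
  rewrite inE => vW cv; have dis := disjoint_nbr_twins cov vW; split.
    rewrite leqNgt; apply: contra noM => lt.
    have [|p [<- mp _ _]] := bipartite_matching dis (@adj_nbr_twins _ G W v) lt.
      by apply: leq_trans cv; rewrite /c; lia.
    exact: contains_matching.
  apply: (induced_deletion_free noF dis (@adj_nbr_twins _ G W v)) => //.
  by apply: leq_trans cv; rewrite leq_addr.
have [/exists_inP[v vW /andP[cv /eqP Ns]] | noFull] :=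
    boolP [exists v in ~: W, (c <= #|twins G W v|) && (#|nbr G v| == s)].
  set S := nbr G v in Ns *; have [_ frS] := rich v vW cv.
  rewrite inE in vW.
  have covS : forall x y, adj G x y -> (x \in S) || (y \in S).
    apply: (full_nbr_cover (X := twins G W v)); rewrite ?Ns //.
    - exact: (disjoint_nbr_twins cov vW).
    - exact: adj_nbr_twins.
    - by apply: leq_trans cv; rewrite leq_addl.
  apply: leq_trans (card_cliques_split G S k.+1) _.
  have cS : #|{: {x | x \in S}}| = s by rewrite card_sig -Ns; apply: eq_card.
  have sum_le : \sum_(u in ~: S) #|cliques_in G (nbr G u) k.+1| <=
                (#|V| - s) * #|cliques_in G S k.+1|.
    have <- : #|~: S| = #|V| - s by rewrite cardsCs setCK Ns.
    rewrite -sum_nat_const; apply: leq_sum => u; rewrite inE => uS.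
    exact/cliques_inS/(nbr_cover covS).
  apply: leq_trans (leq_add (leqnn _) sum_le) _.
  have := leq_ex k.+1 cS frS; rewrite -/m card_cliques_induced.
  (* If [G[S]] attains [m], the tie-breaking maximality of [D] applies. If not, the sum over the
     outside vertices drops by at least [#|V| - s], which outweighs the at most 2^s cliques inside
     [S]. *)
  rewrite leq_eqVlt => /orP[/eqP Em | lt].
    rewrite Em leq_add2r -card_cliques_induced; apply: DF_max => //.
    by rewrite card_cliques_induced.
  have := card_cliques_in G S k.+2; rewrite Ns => le2.
  have le1 : (#|V| - s) * #|cliques_in G S k.+1| <= (#|V| - s) * m.-1.
    by rewrite leq_mul2l -ltnS prednK // lt orbT.
  have -> : (#|V| - s) * m = (#|V| - s) * m.-1 + (#|V| - s).
    by rewrite -{1}(prednK m0) mulnSr.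
  by move: Vlarge le1 le2; nia.
(* Here no rich vertex has [s] neighbours, so its neighbourhood is too small to attain [m]. *)
have richlt v : v \in ~: W -> c <= #|twins G W v| ->
    #|cliques_in G (nbr G v) k.+1| <= m.-1.
  move=> vW cv; have [Ns fr] := rich v vW cv.
  rewrite -ltnS prednK // -card_cliques_induced.
  apply: cliques_lt_ex => //; rewrite card_sig.
  rewrite (eq_card (B := mem (nbr G v))) // ltn_neqAle Ns andbT.
  apply: contraNN noFull => Es.
  by apply/exists_inP; exists v => //; rewrite cv.
apply: leq_trans (card_cliques_split G W k.+1) _.
pose few := [set v in ~: W | #|twins G W v| < c].
have sum_le : \sum_(u in ~: W) #|cliques_in G (nbr G u) k.+1| <=
    #|few| * 2 ^ (2 * s) + #|V| * m.-1.
  (* The few-twin vertices get the crude bound [2 ^ (2 * s)] each, all others [m.-1]. *)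
  rewrite (bigID (fun v => v \in few)) /=; apply: leq_add.
    rewrite -sum_nat_const.
    rewrite (eq_bigl (fun v => v \in few)); last first.
      by move=> v; rewrite andb_idl // inE => /andP[].
    apply: leq_sum => v; rewrite !inE => /andP[vW _].
    apply: leq_trans (cliques_inS _ _ (nbr_cover cov vW)) _.
    exact: leq_trans (card_cliques_in _ _ _) W2.
  rewrite -sum_nat_const big_mkcond /= leq_sum // => v _.
  case: ifP => // /andP[vW]; rewrite inE vW -leqNgt /=; exact: richlt.
have few_le : #|few| <= 2 ^ (2 * s) * c.
  by apply: leq_trans (card_few_twins cov c) _; rewrite leq_mul2r W2 orbT.
have := leq_trans (card_cliques_in G W k.+2) W2.
have : #|few| * 2 ^ (2 * s) <= 2 ^ (2 * s) * c * 2 ^ (2 * s).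
  by rewrite leq_mul2r few_le orbT.
have : #|V| * m = #|V| * m.-1 + #|V| by rewrite -{1}(prednK m0) mulnSr.
move: Vlarge sum_le; rewrite mulnBl; lia.
Qed.
End UpperBound.

(** * The join construction and the lower bound *)

Section Join.
Variables (U I : finType) (D : sgraph U).

Lemma adj_join_edgeless a b :
  adj (join D (edgeless I)) a b = match a, b with
    | inl x, inl y => adj D x y
    | inr _, inr _ => false
    | _, _ => true
    end.
Proof.
rewrite adj_graph_of_rel; case: a b => [x|i] [y|j] //=; last first.
  by rewrite !adj_graph_of_rel !andbF.
rewrite (adj_sym D y) orbb andb_idl // => /adj_neq.
by apply: contraNneq => -[->].
Qed.

(** In a copy of [F], the vertices on the edgeless side form an independent set of [F], and deleting
    them leaves a copy inside [D]. *)
Lemma join_not_contains (T : finType) (F : sgraph T) :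
  free (deletion_family F) D -> ~~ contains F (join D (edgeless I)).
Proof.
move/deletion_freeP => fr; apply/containsP => -[f fI fh].
pose f' x := if f x is inl u then Some u else None.
apply: (fr f'); rewrite /f'; split=> [x y /fh | x y u].
  by rewrite adj_join_edgeless; case: (f x) => [?|?]; case: (f y).
case fx: (f x) => [v|] // [Ev]; case fy: (f y) => [w|] // [Ew].
by apply: fI; rewrite fx fy Ev Ew.
Qed.

(** Every edge of the join has an end in [U], so disjoint edges select distinct elements of [U]. *)
Lemma join_not_contains_matching :
  ~~ contains (matching #|U|.+1) (join D (edgeless I)).
Proof.
apply/containsP => -[f fI fh].
have gP (i : 'I_#|U|.+1) : exists p : bool * U, f (i, p.1) == inl p.2.
  have : adj (join D (edgeless I)) (f (i, false)) (f (i, true)).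
    by apply: fh; rewrite adj_graph_of_rel xpair_eqE !eqxx.
  rewrite adj_join_edgeless; case E0: (f (i, false)) => [u|a].
    by exists (false, u); rewrite /= E0.
  by case E1: (f (i, true)) => [u|b] // _; exists (true, u); rewrite /= E1.
have [g gE] : exists g : 'I_#|U|.+1 -> bool * U,
    forall i, f (i, (g i).1) = inl (g i).2.
  by exists (fun i => xchoose (gP i)) => i; apply/eqP; apply: (xchooseP (gP i)).
have : injective (fun i => (g i).2).
  by move=> i j E; have := gE i; rewrite E -gE => /fI[].
by move/leq_card; rewrite card_ord ltnn.
Qed.

(** Counted are the cliques inside [D] and those made of a clique of [D] and one vertex of [I]. This
    direction suffices, since the join is itself a competitor in [ex] and the upper bound is the
    left-hand sum. *)
Lemma card_cliques_join k :
  #|cliques D k.+1| + #|I| * #|cliques D k|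
    <= #|cliques (join D (edgeless I)) k.+1|.
Proof.
have inlI : injective (@inl U I) by move=> x y [].
have inlE x y : adj D x y = adj (join D (edgeless I)) (inl x) (inl y).
  by rewrite adj_join_edgeless.
pose add (p : I * {set U}) : {set U + I} := inr p.1 |: inl @: p.2.
have addl i B u : inl u \in add (i, B) = (u \in B).
  by rewrite !inE mem_imset.
have addr i B j : inr j \in add (i, B) = (i == j).
  by rewrite !inE eq_sym orbC; case: imsetP => // -[].
have addI : injective add.
  move=> [i B] [j C] E; congr (_, _).
    by have := addr i B j; rewrite E addr eqxx => /esym/eqP.
  by apply/setP => u; rewrite -(addl i) E addl.
rewrite (card_cliques_im inlI inlE) -cardsT -cardsX -(card_imset _ addI).
set X := cliques_in _ _ _; set Y := add @: _.
have dXY : [disjoint X & Y].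
  apply/pred0P => A /=; apply/negP => /andP[AX /imsetP[[i B] _ AE]].
  have : inr i \in A by rewrite AE addr.
  move: AX; rewrite inE => /andP[_ /subsetP sub] /sub.
  by case/imsetP.
have/eqP <- : #|X :|: Y| == #|X| + #|Y| by rewrite (leq_card_setU X Y).2.
apply/subset_leq_card/subsetP => A /setUP[]; first by rewrite inE => /andP[].
move=> /imsetP[[i B] /setXP[_ +] ->]; rewrite inE => /andP[/eqP cB /cliqueP clB].
apply: cliques_add; rewrite !inE card_imset // cB eqxx /=; apply/andP; split.
  apply/cliqueP => _ _ /imsetP[x xB ->] /imsetP[y yB ->] nxy.
  by rewrite -inlE clB //; apply: contraNneq nxy => ->.
by apply/subsetP => _ /imsetP[x xB ->]; rewrite inE adj_join_edgeless.
Qed.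
End Join.

(** * Combination of the two bounds *)

Theorem theorem1p3 (r : nat) (hr : 3 <= r) (T : finType) (F : sgraph T)
    (hF : r < chromatic_number F) :
  exists s0 : nat, forall s : nat, s0 <= s ->
  exists n0 : nat, forall n : nat, n0 <= n ->
  forall D : sgraph 'I_s, D \in DF F s r ->
    ex n (complete 'I_r) [:: Tagged sgraph F; Tagged sgraph (matching s.+1)] =
    ncopies (complete 'I_r) (join D (edgeless 'I_(n - s))).
Proof.
case: r hr hF => [|[|k]] // _ hF.
have T0 : 0 < #|T| by apply: (chromatic_gt0 (F := F)); apply: leq_trans hF.
have [s0 large] := ex_deletion_large hF; exists s0 => s /large m_large.
set m := ex s _ _ in m_large; pose c := 2 ^ (2 * s).
(* This is the size demanded by [cliques_le], plus [s] to guarantee [s <= n]. *)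
exists (c + c * (#|T| + s.+2) * c + s * m + 2 ^ s + s) => n nlarge D DFD.
have sn : s <= n by apply: leq_trans nlarge; rewrite leq_addl.
have fr : free [:: Tagged sgraph F; Tagged sgraph (matching s.+1)]
    (join D (edgeless 'I_(n - s))).
  rewrite /free /= andbT join_not_contains ?(DF_free DFD) //.
  by have := join_not_contains_matching 'I_(n - s) D; rewrite card_ord.
have cU : #|{: 'I_s + 'I_(n - s)}| = n by rewrite card_sum !card_ord subnKC.
rewrite ncopies_complete; apply/eqP; rewrite eqn_leq leq_ex // andbT.
apply/bigmax_leqP => G; rewrite /free /= andbT => /andP[noF noM].
rewrite ncopies_complete.
apply: leq_trans (card_cliques_join _ _ _).
have := cliques_le T0 DFD m_large _ noF noM; rewrite (DF_card DFD) !card_ord.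
apply.
by apply: leq_trans nlarge; rewrite leq_addr.
Qed.
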